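(* Let $D_1,D_2$ be open domains in $\mathbb{C}(\mathbf{i}_1)$, let $(F_{e_1},G_{e_1})$ and $(F_{e_2},G_{e_2})$ be complex generating pairs in $D_1$ and $D_2$ respectively, and let $(F,G)$ be the $\mathbf{j}^*$-generating pair in $D_0=D_1\times_eD_2$ determined by them. Then $w:D_0\to\mathbb{T}$ is a solution on $D_0$ of the $\mathbf{j}$-bicomplex Vekua equations associated with $(F,G)$ if and only if $$w(z_1+z_2\mathbf{i}_2)=w_{e_1}(z_1-z_2\mathbf{i}_1)\,\mathbf{e}_1+w_{e_2}(z_1+z_2\mathbf{i}_1)\,\mathbf{e}_2\qquad\text{on }D_0,$$ where $w_{e_k}:D_k\to\mathbb{C}(\mathbf{i}_1)$ is a solution on $D_k$ of the complex Vekua equation associated with the generating pair $(F_{e_k},G_{e_k})$ for $k=1,2$.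
   Context: **Bicomplex numbers.** $\mathbb{T}=\{w_0+w_1\mathbf{i}_1+w_2\mathbf{i}_2+w_3\mathbf{j}: w_i\in\mathbb{R}\}$ is the commutative real algebra with $\mathbf{i}_1^2=\mathbf{i}_2^2=-1$, $\mathbf{j}^2=1$, $\mathbf{i}_1\mathbf{i}_2=\mathbf{i}_2\mathbf{i}_1=\mathbf{j}$. $\mathbb{C}(\mathbf{i}_1)=\{x+y\mathbf{i}_1:x,y\in\mathbb{R}\}$. Every $\omega\in\mathbb{T}$ is uniquely $\omega=z_1+z_2\mathbf{i}_2$ with $z_1,z_2\in\mathbb{C}(\mathbf{i}_1)$. Conjugations: $\omega^{\dagger_1}=\overline{z}_1+\overline{z}_2\mathbf{i}_2$, $\omega^{\dagger_2}=z_1-z_2\mathbf{i}_2$, $\omega^{\dagger_3}=\overline{z}_1-\overline{z}_2\mathbf{i}_2$. With $\mathbf{e}_1=\frac{1+\mathbf{j}}2$, $\mathbf{e}_2=\frac{1-\mathbf{j}}2$ one has uniquely $z_1+z_2\mathbf{i}_2=(z_1-z_2\mathbf{i}_1)\mathbf{e}_1+(z_1+z_2\mathbf{i}_1)\mathbf{e}_2$. For $D_1,D_2\subset\mathbb{C}(\mathbf{i}_1)$, $D_1\times_e D_2=\{\zeta_1\mathbf{e}_1+\zeta_2\mathbf{e}_2:\zeta_1\in D_1,\zeta_2\in D_2\}$. **Operators.** With $z_k=x_k+y_k\mathbf{i}_1$, $\partial_{z_k}=\frac12(\partial_{x_k}-\mathbf{i}_1\partial_{y_k})$, $\partial_{\bar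 z_k}=\frac12(\partial_{x_k}+\mathbf{i}_1\partial_{y_k})$: $\partial_{\omega^{\dagger_1}}=\frac12(\partial_{\bar z_1}-\mathbf{i}_2\partial_{\bar z_2})$, $\partial_{\omega^{\dagger_2}}=\frac12(\partial_{z_1}+\mathbf{i}_2\partial_{z_2})$, $\partial_{\omega^{\dagger_3}}=\frac12(\partial_{\bar z_1}+\mathbf{i}_2\partial_{\bar z_2})$. Subscripts denote application of these operators. **Complex pairs.** A complex generating pair in an open set $D\subset\mathbb{C}(\mathbf{i}_1)$ is a pair of twice continuously differentiable functions $F,G:D\to\mathbb{C}(\mathbf{i}_1)$ with $\mathrm{Im}(\overline{F}G)\neq0$ on $D$. The associated complex Vekua equation is $w_{\bar z}=a\,w+b\,\overline{w}$ with $a=-\frac{\overline{F}G_{\bar z}-F_{\bar z}\overline{G}}{F\overline{G}-\overline{F}G}$, $b=\frac{FG_{\bar z}-F_{\bar z}G}{F\overline{G}-\overline{F}G}$. **Bicomplex pairs.** The $\mathbf{j}^*$-generating pair in $D_0=D_1\times_eD_2$ determined by $(F_{e_1},G_{e_1})$, $(F_{e_2},G_{e_2})$ is $F(z_1+z_2\mathbf{i}_2)=F_{e_1}(z_1-z_2\mathbf{i}_1)\mathbf{e}_1+F_{e_2}(z_1+z_2\mathbf{i}_1)\mathbf{e}_2$, $G(z_1+z_2\mathbf{i}_2)=G_{e_1}(z_1-z_2\mathbf{i}_1)\mathbf{e}_1+G_{e_2}(z_1+z_2\mathbf{i}_1)\mathbf{e}_2$. The associated $\mathbf{j}$-bicomplex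 Vekua equations are the three equations $w_{\omega^{\dagger_k}}=a^{(k)}w+b^{(k)}w^{\dagger_3}$, $k=1,2,3$, with $$a^{(k)}=-\frac{F^{\dagger_k}G_{\omega^{\dagger_k}}-F_{\omega^{\dagger_k}}G^{\dagger_k}}{FG^{\dagger_3}-F^{\dagger_3}G},\qquad b^{(k)}=\frac{FG_{\omega^{\dagger_k}}-F_{\omega^{\dagger_k}}G}{FG^{\dagger_3}-F^{\dagger_3}G}.$$ Solutions (of either kind of Vekua equation) are understood to have continuous first partial derivatives. *)

(* Defs.v *)
From HB Require Import structures.
From mathcomp Require Import all_boot all_order all_algebra.
From mathcomp Require Import all_classical all_reals all_analysis.
From mathcomp.real_closed Require Export complex.
From mathcomp Require Import ring.

Set Implicit Arguments.
Unset Strict Implicit.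
Unset Printing Implicit Defensive.

Import Order.TTheory GRing.Theory Num.Theory numFieldNormedType.Exports.

Local Open Scope ring_scope.
Local Open Scope complex_scope.
Local Open Scope classical_set_scope.

(* The real-valued projections, not the R[i]-valued ones of Num. *)
Local Notation Re := complex.Re.
Local Notation Im := complex.Im.

(* The usual topology of R[i], namely the one every numFieldType has; the
   library only attaches it to variables of such a type. *)
HB.instance Definition _ (R : realType) :=
  NormedModule.copy R[i] ((R[i] : numFieldType)^o).

(* The pair (z1, z2) stands for z1 + z2 i2. *)
Definition bicomplex (R : realType) : Type := (R[i] * R[i])%type.

HB.instance Definition _ (R : realType) :=
  Topological.copy (bicomplex R) (R[i] * R[i])%type.
HB.instance Definition _ (R : realType) :=
  GRing.Zmodule.copy (bicomplex R) (R[i] * R[i])%type.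

Section BicomplexRing.
Context {R : realType}.
Implicit Types u v : bicomplex R.

Definition mulbc u v : bicomplex R :=
  (u.1 * v.1 - u.2 * v.2, u.1 * v.2 + u.2 * v.1).

Definition onebc : bicomplex R := (1, 0).

Fact mulbcA : associative mulbc.
Proof. by move=> [a b] [c d] [e f]; congr pair => /=; ring. Qed.

Fact mulbcC : commutative mulbc.
Proof. by move=> [a b] [c d]; congr pair => /=; ring. Qed.

Fact mul1bc : left_id onebc mulbc.
Proof. by move=> [a b]; congr pair => /=; ring. Qed.

Fact mulbcDl : left_distributive mulbc +%R.
Proof. by move=> [a b] [c d] [e f]; congr pair => /=; ring. Qed.

Fact onebc_neq0 : onebc != 0.
Proof. by apply/eqP => -[/eqP]; rewrite oner_eq0. Qed.

HB.instance Definition _ := GRing.Zmodule_isComNzRing.Build (bicomplex R)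
  mulbcA mulbcC mul1bc mulbcDl onebc_neq0.

Definition bcnorm u : R[i] := u.1 ^+ 2 + u.2 ^+ 2.

Definition unitbc : pred (bicomplex R) := fun u => bcnorm u != 0.

(* (z1 + z2 i2) (z1 - z2 i2) = z1 ^ 2 + z2 ^ 2; outside the units, the
   inverse is the identity, as everywhere in the library. *)
Definition invbc u : bicomplex R :=
  if unitbc u then (u.1 / bcnorm u, - u.2 / bcnorm u) else u.

Fact mulVbc : {in unitbc, left_inverse 1 invbc *%R}.
Proof.
move=> [a b] ab0; rewrite /invbc ifT //.
have := ab0; rewrite unfold_in /unitbc /bcnorm /= => n0.
by congr pair => /=; field.
Qed.

Fact unitbcP u v : v * u = 1 -> unitbc u.
Proof.
case: u v => [a b] [c d] [e1 e2]; rewrite /unitbc /bcnorm /=.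
have : (c ^+ 2 + d ^+ 2) * (a ^+ 2 + b ^+ 2) = 1 ^+ 2 + 0 ^+ 2.
  by rewrite -{}e1 -{}e2 /=; ring.
move=> E; apply/eqP => n0; move: E; rewrite n0 mulr0 expr0n addr0 expr1n.
by move/eqP; rewrite eq_sym oner_eq0.
Qed.

Fact invbc_out : {in [predC unitbc], invbc =1 id}.
Proof. by move=> u u0; rewrite /invbc ifN. Qed.

HB.instance Definition _ := GRing.ComNzRing_hasMulInverse.Build (bicomplex R)
  mulVbc unitbcP invbc_out.

End BicomplexRing.

Section BicomplexNumbers.
Context {R : realType}.

Definition ofC (z : R[i]) : bicomplex R := (z, 0).
Definition i1 : bicomplex R := ofC 'i%C.
Definition i2 : bicomplex R := (0, 1).
Definition bj : bicomplex R := i1 * i2.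
Definition e1 : bicomplex R := (1 + bj) / 2.
Definition e2 : bicomplex R := (1 - bj) / 2.

Definition dag1 (u : bicomplex R) : bicomplex R :=
  ofC u.1^*%C + ofC u.2^*%C * i2.
Definition dag2 (u : bicomplex R) : bicomplex R := ofC u.1 - ofC u.2 * i2.
Definition dag3 (u : bicomplex R) : bicomplex R :=
  ofC u.1^*%C - ofC u.2^*%C * i2.

Definition eprod (D1 D2 : set R[i]) : set (bicomplex R) :=
  [set ofC z1 * e1 + ofC z2 * e2 | z1 in D1 & z2 in D2].

Definition ecomb (w1 w2 : R[i] -> R[i]) (u : bicomplex R) : bicomplex R :=
  ofC (w1 (u.1 - u.2 * 'i%C)) * e1 + ofC (w2 (u.1 + u.2 * 'i%C)) * e2.

End BicomplexNumbers.

Section BicomplexTheory.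
Context {R : realType}.

Lemma i1_sqr : i1 * i1 = -1 :> bicomplex R.
Proof.
rewrite /i1 /ofC; congr pair; last by rewrite /=; ring.
by rewrite /= mulr0 subr0 -expr2 sqr_i.
Qed.

Lemma i2_sqr : i2 * i2 = -1 :> bicomplex R.
Proof. by congr pair => /=; ring. Qed.

Lemma bj_sqr : bj * bj = 1 :> bicomplex R.
Proof. by rewrite /bj mulrACA i1_sqr i2_sqr mulrNN mulr1. Qed.

Lemma bicomplexE (u : bicomplex R) : u = ofC u.1 + ofC u.2 * i2.
Proof. by case: u => a b; congr pair => /=; ring. Qed.

Lemma two_inv : 2^-1 = ofC 2^-1 :> bicomplex R.
Proof.
have n2 : (2 : R[i]) != 0 by rewrite pnatr_eq0.
have E : 2 * ofC 2^-1 = 1 :> bicomplex R.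
  by congr pair; rewrite /= ?addr0; field.
have U : (2 : bicomplex R) \is a GRing.unit.
  by apply/unitrPr; exists (ofC 2^-1).
by rewrite -[RHS](mulKr U) E mulr1.
Qed.

Lemma e1E : e1 = (2^-1, 'i%C / 2) :> bicomplex R.
Proof. by rewrite /e1 two_inv; congr pair => /=; ring. Qed.

Lemma e2E : e2 = (2^-1, - 'i%C / 2) :> bicomplex R.
Proof. by rewrite /e2 two_inv; congr pair => /=; ring. Qed.

Lemma idempotent_decomposition (z1 z2 : R[i]) :
  ofC z1 + ofC z2 * i2
  = ofC (z1 - z2 * 'i%C) * e1 + ofC (z1 + z2 * 'i%C) * e2 :> bicomplex R.
Proof.
have n2 : (2 : R[i]) != 0 by rewrite pnatr_eq0.
rewrite e1E e2E; congr pair => /=; first by field.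
rewrite !mul0r !addr0 !add0r mulr1.
transitivity (- ('i%C ^+ 2) * z2); first by rewrite sqr_i opprK mul1r.
by field.
Qed.

End BicomplexTheory.

(* Functions on an open set D are total functions, whose values outside D are
   irrelevant: the operators below are local. *)
Section ComplexDerivatives.
Context {R : realType}.
Implicit Types (f : R[i] -> R[i]) (D : set R[i]).

Definition rderivable (h : R -> R[i]) (t : R) : Prop :=
  derivable (fun s => Re (h s)) t 1 /\ derivable (fun s => Im (h s)) t 1.

Definition rderive (h : R -> R[i]) (t : R) : R[i] :=
  (fun s => Re (h s))^`() t +i* (fun s => Im (h s))^`() t.

Definition xslice f (z : R[i]) : R -> R[i] := fun s => f (s +i* Im z).
Definition yslice f (z : R[i]) : R -> R[i] := fun s => f (Re z +i* s).

Definition partial_x f (z : R[i]) : R[i] := rderive (xslice f z) (Re z).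
Definition partial_y f (z : R[i]) : R[i] := rderive (yslice f z) (Im z).

Definition d_z f z : R[i] := 2^-1 * (partial_x f z - 'i%C * partial_y f z).
Definition d_zbar f z : R[i] := 2^-1 * (partial_x f z + 'i%C * partial_y f z).

Definition partials_at f (z : R[i]) : Prop :=
  rderivable (xslice f z) (Re z) /\ rderivable (yslice f z) (Im z).

Definition C1_on D f : Prop := forall z, D z ->
  [/\ partials_at f z, {for z, continuous (partial_x f)}
    & {for z, continuous (partial_y f)}].

Definition C2_on D f : Prop :=
  [/\ C1_on D f, C1_on D (partial_x f) & C1_on D (partial_y f)].

End ComplexDerivatives.

Section ComplexVekua.
Context {R : realType}.
Implicit Types (F G w : R[i] -> R[i]) (D : set R[i]).

Definition generating_pair D F G : Prop :=
  [/\ C2_on D F, C2_on D G & forall z, D z -> Im ((F z)^*%C * G z) != 0].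

Definition vekua_a F G (z : R[i]) : R[i] :=
  - (((F z)^*%C * d_zbar G z - d_zbar F z * (G z)^*%C)
     / (F z * (G z)^*%C - (F z)^*%C * G z)).

Definition vekua_b F G (z : R[i]) : R[i] :=
  (F z * d_zbar G z - d_zbar F z * G z) / (F z * (G z)^*%C - (F z)^*%C * G z).

Definition vekua_solution D F G w : Prop :=
  C1_on D w /\
  forall z, D z -> d_zbar w z = vekua_a F G z * w z + vekua_b F G z * (w z)^*%C.

End ComplexVekua.

Section BicomplexDerivatives.
Context {R : realType}.
Implicit Types (f : bicomplex R -> bicomplex R) (D : set (bicomplex R)).
Implicit Types (op : (R[i] -> R[i]) -> R[i] -> R[i]).

(* op is a differential operator in one complex variable; it is applied to
   both C(i1)-components of f, in the variable z1 (on1), resp. z2 (on2). *)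
Definition on1 op f (u : bicomplex R) : bicomplex R :=
  ofC (op (fun z => (f (z, u.2)).1) u.1)
  + ofC (op (fun z => (f (z, u.2)).2) u.1) * i2.
Definition on2 op f (u : bicomplex R) : bicomplex R :=
  ofC (op (fun z => (f (u.1, z)).1) u.2)
  + ofC (op (fun z => (f (u.1, z)).2) u.2) * i2.

Definition d_dag1 f u : bicomplex R :=
  2^-1 * (on1 d_zbar f u - i2 * on2 d_zbar f u).
Definition d_dag2 f u : bicomplex R :=
  2^-1 * (on1 d_z f u + i2 * on2 d_z f u).
Definition d_dag3 f u : bicomplex R :=
  2^-1 * (on1 d_zbar f u + i2 * on2 d_zbar f u).

Definition bc_partials_at f (u : bicomplex R) : Prop :=
  [/\ partials_at (fun z => (f (z, u.2)).1) u.1,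
      partials_at (fun z => (f (z, u.2)).2) u.1,
      partials_at (fun z => (f (u.1, z)).1) u.2
    & partials_at (fun z => (f (u.1, z)).2) u.2].

Definition bc_C1_on D f : Prop := forall u, D u ->
  bc_partials_at f u /\
  [/\ {for u, continuous (on1 partial_x f)},
      {for u, continuous (on1 partial_y f)},
      {for u, continuous (on2 partial_x f)}
    & {for u, continuous (on2 partial_y f)}].

End BicomplexDerivatives.

Section BicomplexVekua.
Context {R : realType}.
Implicit Types (F G w : bicomplex R -> bicomplex R) (D : set (bicomplex R)).

Definition bc_fun := bicomplex R -> bicomplex R.

Variant conj_index := K1 | K2 | K3.

Definition dag (k : conj_index) : bc_fun :=
  match k with K1 => dag1 | K2 => dag2 | K3 => dag3 end.

Definition d_dag (k : conj_index) : bc_fun -> bc_fun :=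
  match k with K1 => d_dag1 | K2 => d_dag2 | K3 => d_dag3 end.

Definition bc_vekua_a k F G (u : bicomplex R) : bicomplex R :=
  - ((dag k (F u) * d_dag k G u - d_dag k F u * dag k (G u))
     / (F u * dag3 (G u) - dag3 (F u) * G u)).

Definition bc_vekua_b k F G (u : bicomplex R) : bicomplex R :=
  (F u * d_dag k G u - d_dag k F u * G u)
  / (F u * dag3 (G u) - dag3 (F u) * G u).

Definition bc_vekua_solution D F G w : Prop :=
  bc_C1_on D w /\
  forall k u, D u ->
    d_dag k w u = bc_vekua_a k F G u * w u + bc_vekua_b k F G u * dag3 (w u).

End BicomplexVekua.

(* Main.v *)
Require Import Defs.
From mathcomp Require Import all_boot all_order all_algebra.
From mathcomp Require Import all_classical all_reals all_analysis.
From mathcomp Require Import ring.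

(** Write every bicomplex number in its idempotent coordinates, so that the ring
    becomes a product of two copies of the complex numbers; up to a linear change
    of variables a bicomplex function is then a pair of complex functions of two
    complex variables.  The coordinates ([ecoord]) are ring morphisms, they turn
    the third conjugation into complex conjugation and they send the pair
    [(F, G)] to the two given complex generating pairs.

    The theorem rests on what the three operators become in these coordinates.
    The third one acts on each coordinate as the Cauchy-Riemann operator in the
    variable of that coordinate ([ecoord_d_dag3]).  The first and the second act
    on each coordinate as the two complex derivatives in the variable of the
    other coordinate ([ecoordN_d_dag1], [ecoordN_d_dag2]).  Since [F] and [G] are
    split, the first two operators kill them, the coefficients of the first two
    equations vanish, and these equations say exactly that each coordinate of [w]
    has zero derivatives in the variable of the other one.  As the domains are
    connected, each coordinate of [w] depends on its own variable only
    ([ecoordN_slice_constant]), that is, [w] is split.  The third equation is then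
    the complex Vekua equation in each coordinate ([ecoord_bc_vekua3]).

    The analytic content is the change of variables.  Going to idempotent
    coordinates, a partial derivative becomes a derivative along a diagonal in a
    plane of two real variables, and continuity of the partial derivatives is
    needed for the chain rule ([is_derive_diagonal], [epoint_partials]).  Going
    back, a split function composed with a coordinate only meets translations and
    reflections of each real variable ([idem_fun_C1_on]). *)

Set Implicit Arguments.
Unset Strict Implicit.
Unset Printing Implicit Defensive.

Import Order.TTheory GRing.Theory Num.Theory numFieldNormedType.Exports.

Local Open Scope ring_scope.
Local Open Scope complex_scope.
Local Open Scope classical_set_scope.

Local Notation Re := complex.Re.
Local Notation Im := complex.Im.

(** * A chain rule along a line for functions of two real variables *)

Lemma is_derive_difference_quotient (R : realType) (f : R -> R) (a df : R) :
 h^-1 *: (f (h + a) - f a) @[h --> 0^'] --> df -> is_derive a 1 f df.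
Proof.
move=> H.
have H2 : h^-1 *: ((f \o shift a) (h *: 1) - f a) @[h --> 0^'] --> df.
  by under eq_fun do rewrite /= /shift [_%:A]mulr1.
split.
  by apply/cvg_ex; exists df.
exact: cvg_lim H2.
Qed.

(** The mean value theorem with one endpoint fixed at the centre of an interval,
    so that the sign of the increment need not be discussed by its users. *)
Lemma mvt_ball (R : realType) (f df : R -> R) (a d x : R) :
  (forall y, `|y - a| < d -> is_derive y 1 f (df y)) -> `|x - a| < d ->
  exists2 c, `|c - a| <= `|x - a| & f x - f a = df c * (x - a).
Proof.
move=> fd xa.
have fc y : `|y - a| < d -> {for y, continuous f}.
  move=> /fd [fy _]; exact/differentiable_continuous/derivable1_diffP.
have seg l u : l <= u -> (forall y, y \in `[l, u]%R -> `|y - a| < d) ->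
    exists2 c, c \in `[l, u]%R & f u - f l = df c * (u - l).
  move=> lu H; apply: MVT_segment => //.
    move=> y yi; apply: fd; apply: H.
    exact: subset_itv_oo_cc.
  apply: continuous_in_subspaceT => y; rewrite inE => yi; exact/fc/H.
have [ax|ax] := leP a x.
  have [|c] := seg a x ax.
    move=> y; rewrite in_itv /= => /andP[ay yx]; apply: le_lt_trans xa.
    by rewrite !ger0_norm ?subr_ge0 ?lerD2r.
  rewrite in_itv /= => /andP[ac cx] e; exists c => //.
  by rewrite !ger0_norm ?subr_ge0 ?lerD2r.
have [|c] := seg x a (ltW ax).
  move=> y; rewrite in_itv /= => /andP[xy ya]; apply: le_lt_trans xa.
  by rewrite ![`|_ - a|]distrC !ger0_norm ?subr_ge0 ?lerB // ltW.
rewrite in_itv /= => /andP[xc ca] e; exists c.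
  by rewrite ![`|_ - a|]distrC !ger0_norm ?subr_ge0 ?lerB // ltW.
by rewrite -opprB e -mulrN opprB.
Qed.

Lemma is_derive_affine (R : realType) (f : R -> R) (al c t df : R) :
  is_derive (al * t + c) 1 f df ->
  is_derive t 1 (fun s => f (al * s + c)) (al * df).
Proof.
move=> fd.
have H : is_derive t (1 : R) (fun s => al * s + c) al.
  by apply: is_derive_eq; rewrite addr0 [_%:A]mulr1.
rewrite mulrC.
exact: (@is_derive1_comp R f (fun s => al * s + c) t df al).
Qed.

(** The increment is split into a step in the first variable, at the moved value
    of the second, and a step in the second variable at the base point.  By the
    mean value theorem the first step is a value of [p] at a nearby point times
    [al * h], and continuity of [p] at [(a, b)] gives its limit; the second step
    is a composition with an affine map.  This accounts for the asymmetry of the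
    hypotheses, local in the first variable and pointwise in the second. *)
Lemma is_derive_diagonal (R : realType) (f p : R -> R -> R) (a b al be q : R) :
  (\forall x \near (a, b), is_derive (x.1 : R) (1 : R) (f ^~ x.2) (p x.1 x.2)) ->
  {for (a, b), continuous (fun x : R * R => p x.1 x.2)} ->
  is_derive b 1 (f a) q ->
  is_derive (0 : R) 1 (fun s => f (al * s + a) (be * s + b)) (al * p a b + be * q).
Proof.
move=> fd pc fb.
pose r s := f (al * s + a) (be * s + b) - f a (be * s + b).
have -> : (fun s => f (al * s + a) (be * s + b)) =
    r + (fun s => f a (be * s + b)).
  by apply/funext => s; rewrite /r fctE subrK.
apply: is_deriveD; last by apply: is_derive_affine; rewrite mulr0 add0r.
apply: is_derive_difference_quotient; apply/cvgrPdist_le => /= e e0.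
(* The summand 1 covers al = 0. *)
pose e' := e / (1 + `|al|).
have k0 : 0 < 1 + `|al| by rewrite ltr_pwDl.
have e'0 : 0 < e' by rewrite divr_gt0.
have : \forall x \near (a, b), is_derive (x.1 : R) (1 : R) (f ^~ x.2) (p x.1 x.2) /\
    `|p a b - p x.1 x.2| < e'.
  by apply: filterI => //; move/cvgrPdist_lt : pc; apply.
move=> /nbhs_ballP[d /= d0 dP].
have near0 k : \forall h \near 0^', `|k * h| < d.
  have : k * h @[h --> (0 : R)] --> k * 0 by apply: cvgMr; exact: cvg_id.
  rewrite mulr0 => /cvgrPdist_lt /(_ d d0) H.
  apply: nbhs_dnbhs; apply: filterS H => h; by rewrite sub0r normrN.
have hn0 : \forall h \near (0 : R)^', h != 0 by exact: nbhs_dnbhs_neq.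
near=> h.
have h0 : h != 0 by near: h.
have ah : `|al * h| < d by near: h.
have bh : `|be * h| < d by near: h.
have Pd y : `|y - a| < d -> is_derive y 1 (f ^~ (be * h + b)) (p y (be * h + b))
    /\ `|p a b - p y (be * h + b)| < e'.
  move=> ya; apply: (dP (y, be * h + b)); split => /=.
    by rewrite /ball /= distrC.
  by rewrite /ball /= opprD addrCA subrr addr0 normrN.
have [|c ca] := @mvt_ball R (f ^~ (be * h + b)) (fun y => p y (be * h + b))
    a d (al * h + a) (fun y ya => (Pd y ya).1).
  by rewrite addrK.
rewrite addrK in ca *; move=> E.
have -> : r 0 = 0 by rewrite /r !mulr0 !add0r subrr.
rewrite addr0 subr0 /r E.
have -> : al * p a b - h^-1 *: (p c (be * h + b) * (al * h)) =
  al * (p a b - p c (be * h + b)).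
  by rewrite /GRing.scale /=; field.
rewrite normrM.
have /Pd[_ /ltW pc'] : `|c - a| < d by exact: le_lt_trans ah.
apply: (@le_trans _ _ (`|al| * e')); first exact: ler_wpM2l.
rewrite /e' mulrCA ler_piMr ?ltW // ltr_pdivrMr // mul1r.
by rewrite ltrDr.
Unshelve. all: by end_near. Qed.

(** * Complex-valued functions of a real variable *)

(** A relational form of [rderivable] and [rderive]: existence and value of the
    derivative are carried together through linear combinations. *)
Definition is_rderive (R : realType) (h : R -> R[i]) (t : R) (l : R[i]) : Prop :=
  is_derive t 1 (fun s => Re (h s)) (Re l) /\
  is_derive t 1 (fun s => Im (h s)) (Im l).

Lemma rderivableP (R : realType) (h : R -> R[i]) (t : R) :
  rderivable h t -> is_rderive h t (rderive h t).
Proof.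
by move=> [h1 h2]; split; rewrite /= derive1E; exact: derivableP.
Qed.

Lemma is_rderiveP (R : realType) (h : R -> R[i]) (t : R) (l : R[i]) :
  is_rderive h t l -> rderivable h t /\ rderive h t = l.
Proof.
move=> [h1 h2]; split; first by split; apply: ex_derive.
by rewrite /rderive !derive1E !derive_val; case: l {h1 h2}.
Qed.

Lemma is_rderiveD (R : realType) (h k : R -> R[i]) (t : R) (l m : R[i]) :
  is_rderive h t l -> is_rderive k t m ->
  is_rderive (fun s => h s + k s) t (l + m).
Proof.
move=> [h1 h2] [k1 k2]; split; rewrite raddfD /=.
  have -> : (fun s => Re (h s + k s)) = (fun s => Re (h s)) + (fun s => Re (k s)).
    by apply/funext => s; rewrite raddfD.
  exact: is_deriveD.
have -> : (fun s => Im (h s + k s)) = (fun s => Im (h s)) + (fun s => Im (k s)).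
  by apply/funext => s; rewrite raddfD.
exact: is_deriveD.
Qed.

Lemma is_rderiveZ (R : realType) (c : R[i]) (h : R -> R[i]) (t : R) (l : R[i]) :
  is_rderive h t l -> is_rderive (fun s => c * h s) t (c * l).
Proof.
case: c l => c d [l m] [/= h1 h2]; split => /=.
  have reM (z : R[i]) : Re ((c +i* d) * z) = c * Re z - d * Im z by case: z.
  have -> : (fun s => Re ((c +i* d) * h s)) =
      (c \*: (fun s => Re (h s))) - (d \*: (fun s => Im (h s))).
    by apply/funext => s; exact: reM.
  exact: is_deriveB.
have imM (z : R[i]) : Im ((c +i* d) * z) = c * Im z + d * Re z by case: z.
have -> : (fun s => Im ((c +i* d) * h s)) =
    (c \*: (fun s => Im (h s))) + (d \*: (fun s => Re (h s))).
  by apply/funext => s; exact: imM.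
exact: is_deriveD.
Qed.

Lemma near_eq_is_rderive (R : realType) (h k : R -> R[i]) (t : R) (l : R[i]) :
  (\forall s \near t, h s = k s) -> is_rderive h t l -> is_rderive k t l.
Proof.
move=> hk [h1 h2]; split.
  by apply: near_eq_is_derive h1; apply: filterS hk => s ->.
by apply: near_eq_is_derive h2; apply: filterS hk => s ->.
Qed.

Lemma is_rderive_affine (R : realType) (h : R -> R[i]) (al c t : R) (l : R[i]) :
  is_rderive h (al * t + c) l ->
  is_rderive (fun s => h (al * s + c)) t (al%:C * l).
Proof.
case: l => l m [h1 h2]; split => /=; rewrite mul0r ?subr0 ?addr0.
  exact: (@is_derive_affine _ (fun s => Re (h s))).
exact: (@is_derive_affine _ (fun s => Im (h s))).
Qed.

(** * Continuity of the real coordinates *)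

Lemma normc_i (R : realType) : `|'i%C : R[i]| = 1.
Proof. by rewrite normc_def /= expr0n expr1n add0r sqrtr1. Qed.

Lemma normc_realC (R : realType) (x : R) : `|x%:C| = `|x|%:C.
Proof. by rewrite normc_def /= expr0n addr0 sqrtr_sqr. Qed.

Lemma continuous_Re (R : realType) : continuous (@complex.Re R).
Proof.
move=> z; apply/(@cvgrPdist_lt _ _ _ (nbhs z)) => e e0; apply/nbhs_ballP; exists e%:C => /=.
  by rewrite ltcR.
move=> y; rewrite /ball /= => zy; rewrite -ltcR; apply: le_lt_trans zy.
by rewrite -raddfB normc_ge_Re.
Qed.

Lemma continuous_Im (R : realType) : continuous (@complex.Im R).
Proof.
move=> z; apply/(@cvgrPdist_lt _ _ _ (nbhs z)) => e e0; apply/nbhs_ballP; exists e%:C => /=.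
  by rewrite ltcR.
move=> y; rewrite /ball /= => zy; rewrite -ltcR; apply: le_lt_trans zy.
have -> : Im z - Im y = Re (- 'i%C * (z - y)).
  by case: z y => [a b] [c d] /=; ring.
by apply: le_trans (normc_ge_Re _) _; rewrite normrM normrN normc_i mul1r.
Qed.

Lemma continuous_Complex (R : realType) :
  continuous (fun x : R * R => (x.1 +i* x.2 : R[i])).
Proof.
move=> [a b]; apply/(@cvgrPdist_lt _ _ _ (nbhs (a, b))) => -[e e'].
rewrite ltcE /= => /andP[/eqP -> e0].
have e20 : 0 < e / 2 by rewrite divr_gt0.
apply/(@nbhs_ballP _ _ (a, b)); exists (e / 2) => //= -[c d] [/= ac bd].
have -> : (a +i* b) - (c +i* d) = (a - c)%:C + 'i%C * (b - d)%:C.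
  by apply/eqP; rewrite eq_complex /=; apply/andP; split; apply/eqP; ring.
apply: le_lt_trans (ler_normD _ _) _.
rewrite normrM normc_i mul1r !normc_realC -raddfD /= ltcR.
by rewrite [e]splitr ltrD.
Qed.

Lemma is_rderive_diagonal (R : realType) (f p : R -> R -> R[i])
    (a b al be : R) (q : R[i]) :
  (\forall x \near (a, b), is_rderive (f ^~ x.2) x.1 (p x.1 x.2)) ->
  {for (a, b), continuous (fun x : R * R => p x.1 x.2)} ->
  is_rderive (f a) b q ->
  is_rderive (fun s => f (al * s + a) (be * s + b)) 0 (al%:C * p a b + be%:C * q).
Proof.
move=> fd pc [fb1 fb2]; split; rewrite raddfD.
  have -> : Re (al%:C * p a b) + Re (be%:C * q) = al * Re (p a b) + be * Re q.
    by case: (p a b) q {fb1 fb2} => ? ? [? ?] /=; ring.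
  apply: (@is_derive_diagonal _ (fun x y => Re (f x y)) (fun x y => Re (p x y))) => //.
    by apply: filterS fd => x [].
  apply: (@continuous_comp _ _ _ (fun x : R * R => p x.1 x.2) (@complex.Re R)) => //.
  exact: continuous_Re.
have -> : Im (al%:C * p a b) + Im (be%:C * q) = al * Im (p a b) + be * Im q.
  by case: (p a b) q {fb1 fb2} => ? ? [? ?] /=; ring.
apply: (@is_derive_diagonal _ (fun x y => Im (f x y)) (fun x y => Im (p x y))) => //.
  by apply: filterS fd => x [].
apply: (@continuous_comp _ _ _ (fun x : R * R => p x.1 x.2) (@complex.Im R)) => //.
exact: continuous_Im.
Qed.

(** * Idempotent coordinates *)

Section IdempotentCoordinates.
Context {R : realType}.
Implicit Types (s : R) (u v : bicomplex R) (z : R[i]).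

(** For [s = 1] this is the coefficient of [e1] in [u], for [s = -1] that of
    [e2].  Treating the sign as a parameter subject to [s * s = 1] makes the two
    halves of every argument a single one. *)
Definition ecoord s u : R[i] := u.1 - s%:C * 'i%C * u.2.

(** The bicomplex number whose coordinates of signs [s] and [- s] are [z] and
    [z']; this is the inverse of the change of variables made by [ecoord]. *)
Definition epoint s z z' : bicomplex R :=
  (2^-1 * (z + z'), 2^-1 * (s%:C * 'i%C) * (z - z')).

Lemma sqr_si s : s * s = 1 -> (s%:C * 'i%C) * (s%:C * 'i%C) = -1 :> R[i].
Proof. by move=> s2; rewrite mulrACA -rmorphM s2 -expr2 sqr_i mul1r. Qed.

Lemma ecoordD s u v : ecoord s (u + v) = ecoord s u + ecoord s v.
Proof. by rewrite /ecoord /=; ring. Qed.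

Lemma ecoordN s u : ecoord s (- u) = - ecoord s u.
Proof. by rewrite /ecoord /=; ring. Qed.

Lemma ecoordM s u v : s * s = 1 -> ecoord s (u * v) = ecoord s u * ecoord s v.
Proof.
move=> /sqr_si s2; case: u v => [a b] [c d]; rewrite /ecoord /=.
by ring: s2.
Qed.

Lemma ecoord_ofC s z : ecoord s (ofC z) = z.
Proof. by rewrite /ecoord /= mulr0 subr0. Qed.

Lemma ecoord_i2 s : ecoord s i2 = - (s%:C * 'i%C).
Proof. by rewrite /ecoord /= mulr1 sub0r. Qed.

Lemma half_double : 2 * 2^-1 = 1 :> R[i].
Proof. by rewrite divff // pnatr_eq0. Qed.

Lemma ecoord_dag3 s u : ecoord s (dag3 u) = (ecoord s u)^*%C.
Proof.
case: u => [[a b] [c d]]; rewrite /ecoord.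
by apply/eqP; rewrite eq_complex /=; apply/andP; split; apply/eqP; ring.
Qed.

Lemma ecoord_epoint s z z' : s * s = 1 -> ecoord s (epoint s z z') = z.
Proof.
move=> /sqr_si s2; rewrite /ecoord /epoint /=.
by ring: s2 half_double.
Qed.

Lemma ecoordN_epoint s z z' : s * s = 1 -> ecoord (- s) (epoint s z z') = z'.
Proof.
move=> /sqr_si s2; rewrite /ecoord /epoint /= rmorphN /=.
by ring: s2 half_double.
Qed.

Lemma epoint_ecoord s u : s * s = 1 -> epoint s (ecoord s u) (ecoord (- s) u) = u.
Proof.
move=> /sqr_si s2; case: u => a b; rewrite /ecoord /epoint /= rmorphN /=.
by congr pair; ring: s2 half_double.
Qed.

Lemma ecoord_inj s u v : s * s = 1 ->
  ecoord s u = ecoord s v -> ecoord (- s) u = ecoord (- s) v -> u = v.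
Proof. by move=> s2 e e'; rewrite -[u](epoint_ecoord _ s2) e e' epoint_ecoord. Qed.

(** A bicomplex number is a unit exactly when both idempotent coordinates are
    nonzero; this is what lets the quotients in the Vekua coefficients be
    computed coordinate by coordinate. *)
Lemma bcnorm_ecoord s u : s * s = 1 -> bcnorm u = ecoord s u * ecoord (- s) u.
Proof.
move=> /sqr_si s2; case: u => a b; rewrite /ecoord /bcnorm /= rmorphN /=.
by ring: s2.
Qed.

Lemma ecoordV s u : s * s = 1 -> ecoord s u != 0 -> ecoord (- s) u != 0 ->
  ecoord s u^-1 = (ecoord s u)^-1.
Proof.
move=> s2 u0 u0'; have U : u \is a GRing.unit.
  by rewrite unfold_in /= /unitbc (bcnorm_ecoord _ s2) mulf_neq0.
apply: (mulfI u0); rewrite divff // -ecoordM // divrr //.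
by rewrite /ecoord /= mulr0 subr0.
Qed.

Lemma eprodE (D1 D2 : set R[i]) u :
  eprod D1 D2 u <-> D1 (ecoord 1 u) /\ D2 (ecoord (- 1) u).
Proof.
have E z1 z2 : ofC z1 * e1 + ofC z2 * e2 = epoint 1 z1 z2.
  rewrite e1E e2E /epoint; congr pair => /=; ring.
split=> [[z1 D1z1 [z2 D2z2 <-]]|[h1 h2]].
  by rewrite E ecoord_epoint ?mulr1 // ecoordN_epoint ?mulr1.
by exists (ecoord 1 u) => //; exists (ecoord (- 1) u) => //; rewrite E epoint_ecoord ?mulr1.
Qed.

Lemma ecombE (w1 w2 : R[i] -> R[i]) u :
  ecomb w1 w2 u = epoint 1 (w1 (ecoord 1 u)) (w2 (ecoord (- 1) u)).
Proof.
have -> : ecoord 1 u = u.1 - u.2 * 'i%C by rewrite /ecoord mul1r mulrC.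
have -> : ecoord (-1) u = u.1 + u.2 * 'i%C.
  by rewrite /ecoord rmorphN mulN1r mulNr opprK mulrC.
by rewrite /ecomb e1E e2E /epoint; congr pair => /=; ring.
Qed.

End IdempotentCoordinates.

(** * Stability of continuity at a point *)

Section Continuity.
Context {R : realType}.
Variables (T : topologicalType) (x : T).

Lemma continuousD_at (f g : T -> R[i]) :
  {for x, continuous f} -> {for x, continuous g} ->
  {for x, continuous (fun y => f y + g y)}.
Proof. exact: (@cvgD R[i] _ _ (nbhs x)). Qed.

Lemma continuousMl_at (f : T -> R[i]) (c : R[i]) :
  {for x, continuous f} -> {for x, continuous (fun y => c * f y)}.
Proof.
move=> fc; apply: (@continuous_comp T R[i] R[i] f (fun z => c * z) x fc).
exact: (@mulrl_continuous R[i] c (f x)).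
Qed.

Lemma continuous_pair_at (f g : T -> R[i]) :
  {for x, continuous f} -> {for x, continuous g} ->
  {for x, continuous (fun y => (f y, g y) : bicomplex R)}.
Proof.
move=> fc gc.
exact: (@cvg_pair T R[i] R[i] (nbhs x) (nbhs (f x)) (nbhs (g x)) _ _ _ f g fc gc).
Qed.

Lemma continuous_fst_at (f : T -> bicomplex R) :
  {for x, continuous f} -> {for x, continuous (fun y => (f y).1)}.
Proof.
move=> fc.
refine (@cvg_comp T (bicomplex R) R[i] f (@fst R[i] R[i])
  (nbhs x) (nbhs (f x)) (nbhs (f x).1) fc _).
exact: cvg_fst.
Qed.

Lemma continuous_snd_at (f : T -> bicomplex R) :
  {for x, continuous f} -> {for x, continuous (fun y => (f y).2)}.
Proof.
move=> fc.
refine (@cvg_comp T (bicomplex R) R[i] f (@snd R[i] R[i])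
  (nbhs x) (nbhs (f x)) (nbhs (f x).2) fc _).
exact: cvg_snd.
Qed.

Lemma near_eq_continuous_at (U : topologicalType) (f g : T -> U) :
  (\forall y \near x, f y = g y) -> {for x, continuous f} -> {for x, continuous g}.
Proof.
move=> fg fc; have E := nbhs_singleton fg.
have : f @ x --> g x by rewrite -E.
by apply: cvg_trans; apply: near_eq_cvg; apply: filterS fg.
Qed.

Lemma continuous_ecoord_at (s : R) (f : T -> bicomplex R) :
  {for x, continuous f} -> {for x, continuous (fun y => ecoord s (f y))}.
Proof.
move=> fc.
have -> : (fun y => ecoord s (f y)) =
    (fun y => (f y).1 + - (s%:C * 'i%C) * (f y).2).
  by apply/funext => y; rewrite /ecoord mulNr.
apply: continuousD_at; first exact: continuous_fst_at.
exact/continuousMl_at/continuous_snd_at.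
Qed.

Lemma continuous_epoint_at (s : R) (f g : T -> R[i]) :
  {for x, continuous f} -> {for x, continuous g} ->
  {for x, continuous (fun y => epoint s (f y) (g y))}.
Proof.
move=> fc gc; apply: continuous_pair_at; apply: continuousMl_at.
  exact: continuousD_at.
have -> : (fun y => f y - g y) = (fun y => f y + (-1) * g y).
  by apply/funext => y; rewrite mulN1r.
exact/continuousD_at/continuousMl_at.
Qed.

Lemma continuous_Complex_at (f g : T -> R) :
  {for x, continuous f} -> {for x, continuous g} ->
  {for x, continuous (fun y => (f y +i* g y : R[i]))}.
Proof.
move=> fc gc.
apply: (@continuous_comp _ _ _ (fun y => (f y, g y)) (fun p : R * R => (p.1 +i* p.2))).
  exact: (@cvg_pair T R R (nbhs x) (nbhs (f x)) (nbhs (g x))).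
exact: continuous_Complex.
Qed.

End Continuity.

(** * Functions with zero partial derivatives *)

Lemma partials_atP (R : realType) (f : R[i] -> R[i]) (z : R[i]) :
  partials_at f z ->
  is_rderive (xslice f z) (Re z) (partial_x f z) /\
  is_rderive (yslice f z) (Im z) (partial_y f z).
Proof. by move=> [/rderivableP fx /rderivableP fy]. Qed.

Lemma is_partials (R : realType) (f : R[i] -> R[i]) (z : R[i]) (l m : R[i]) :
  is_rderive (xslice f z) (Re z) l -> is_rderive (yslice f z) (Im z) m ->
  [/\ partials_at f z, partial_x f z = l & partial_y f z = m].
Proof. by move=> /is_rderiveP[? ?] /is_rderiveP[? ?]. Qed.

Section LocallyConstant.
Context {R : realType}.

Lemma rderive0_constant (h : R -> R[i]) (a d x : R) :
  (forall y, `|y - a| < d -> is_rderive h y 0) -> `|x - a| < d -> h x = h a.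
Proof.
move=> h0 xa.
have [|c _] := @mvt_ball _ (fun t => Re (h t)) (fun=> 0) a d x _ xa.
  by move=> y /h0[].
have [|c' _] := @mvt_ball _ (fun t => Im (h t)) (fun=> 0) a d x _ xa.
  by move=> y /h0[].
rewrite !mul0r => /eqP; rewrite subr_eq0 => /eqP eI /eqP; rewrite subr_eq0 => /eqP eR.
by apply/eqP; rewrite eq_complex eI eR !eqxx.
Qed.

Lemma locally_constant_connected (T : topologicalType) (D : set T) (U : Type) (g : T -> U) :
  open D -> connected D ->
  (forall x, D x -> \forall y \near x, g y = g x) ->
  forall x y, D x -> D y -> g x = g y.
Proof.
move=> oD cD gD x y Dx Dy.
have opn (P : set U) : open (D `&` [set t | P (g t)]).
  rewrite openE => t [Dt Pt]; rewrite /interior /=.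
  apply: filterI; first exact: open_nbhs_nbhs.
  by apply: filterS (gD _ Dt) => t' /= ->.
have E : D `&` [set t | g t = g x] = D.
  apply: cD.
  - by exists x.
  - exists (D `&` [set t | g t = g x]); first exact: (opn [set g x]).
    by rewrite setIA setIid.
  exists (~` (D `&` [set t | g t <> g x])).
    by apply: open_closedC; exact: (opn [set v | v <> g x]).
  apply/seteqP; split => t [Dt]; first by move=> /= e; split => // -[].
  by move=> n; split => //=; apply: contrapT => e; apply: n.
by have [_ ->] : (D `&` [set t | g t = g x]) y by rewrite E.
Qed.

(** Around a point of [D] the function is constant along a horizontal step
    followed by a vertical one, because a small square lies in [D]; connectedness
    makes the locally constant function constant. *)
Lemma partials0_constant (D : set R[i]) (g : R[i] -> R[i]) :
  open D -> connected D ->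
  (forall z, D z -> [/\ partials_at g z, partial_x g z = 0 & partial_y g z = 0]) ->
  forall z z', D z -> D z' -> g z = g z'.
Proof.
move=> oD cD g0; apply: locally_constant_connected => // -[a b] Dz.
have nD : \forall p \near (a, b), D (p.1 +i* p.2).
  by apply: (@continuous_Complex R (a, b)); exact: open_nbhs_nbhs.
move: nD => /(@nbhs_ballP _ _ (a, b)) [d /= d0 dD].
have {dD} Dd x y : `|x - a| < d -> `|y - b| < d -> D (x +i* y).
  move=> xa yb; apply: (dD (x, y)); split; by rewrite /ball /= distrC.
have nRe : \forall z \near a +i* b, `|Re z - a| < d.
  have /(@cvgrPdist_lt _ _ _ (nbhs (a +i* b))) /(_ _ d0) := @continuous_Re R (a +i* b).
  by apply: filterS => z; rewrite distrC.
have nIm : \forall z \near a +i* b, `|Im z - b| < d.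
  have /(@cvgrPdist_lt _ _ _ (nbhs (a +i* b))) /(_ _ d0) := @continuous_Im R (a +i* b).
  by apply: filterS => z; rewrite distrC.
apply: filterS2 nRe nIm => -[x y] /= xa yb.
transitivity (g (a +i* y)).
  apply: (@rderive0_constant (fun t => g (t +i* y)) a d x) => // t ta.
  have [/partials_atP[gx _] e _] := g0 _ (Dd _ _ ta yb).
  by rewrite e in gx.
apply: (@rderive0_constant (fun t => g (a +i* t)) b d y) => // t tb.
have aa : `|a - a| < d by rewrite subrr normr0.
have [/partials_atP[_ gy] _ e] := g0 _ (Dd _ _ aa tb).
by rewrite e in gy.
Qed.

End LocallyConstant.

(** * Partial derivatives of bicomplex functions *)

Section BicomplexPartials.
Context {R : realType}.
Implicit Types (f w : bicomplex R -> bicomplex R) (u : bicomplex R).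

(** The derivative of a bicomplex-valued function of a real variable, taken on
    the two complex components in the basis [1, i2]. *)
Definition is_bderive (h : R -> bicomplex R) (t : R) (l : bicomplex R) : Prop :=
  is_rderive (fun x => (h x).1) t l.1 /\ is_rderive (fun x => (h x).2) t l.2.

Definition has_partials f u X1 Y1 X2 Y2 : Prop :=
  [/\ is_bderive (fun t => f (t +i* Im u.1, u.2)) (Re u.1) X1,
      is_bderive (fun t => f (Re u.1 +i* t, u.2)) (Im u.1) Y1,
      is_bderive (fun t => f (u.1, t +i* Im u.2)) (Re u.2) X2
    & is_bderive (fun t => f (u.1, Re u.2 +i* t)) (Im u.2) Y2].

Lemma on1E op f u : on1 op f u =
  (op (fun z => (f (z, u.2)).1) u.1, op (fun z => (f (z, u.2)).2) u.1).
Proof. by rewrite /on1 [RHS]bicomplexE. Qed.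

Lemma on2E op f u : on2 op f u =
  (op (fun z => (f (u.1, z)).1) u.2, op (fun z => (f (u.1, z)).2) u.2).
Proof. by rewrite /on2 [RHS]bicomplexE. Qed.

Lemma bc_partials_atP f u : bc_partials_at f u ->
  has_partials f u (on1 partial_x f u) (on1 partial_y f u)
                   (on2 partial_x f u) (on2 partial_y f u).
Proof.
move=> [/partials_atP[a1 b1] /partials_atP[a2 b2] /partials_atP[a3 b3] /partials_atP[a4 b4]].
by rewrite !on1E !on2E; split; split.
Qed.

Lemma has_partialsP f u X1 Y1 X2 Y2 : has_partials f u X1 Y1 X2 Y2 ->
  bc_partials_at f u /\
  [/\ on1 partial_x f u = X1, on1 partial_y f u = Y1,
      on2 partial_x f u = X2 & on2 partial_y f u = Y2].
Proof.
case: X1 Y1 X2 Y2 => [X1 X1'] [Y1 Y1'] [X2 X2'] [Y2 Y2'].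
move=> [[x1 x1'] [y1 y1'] [x2 x2'] [y2 y2']].
rewrite /bc_partials_at !on1E !on2E.
have [? -> ->] := is_partials (f := fun z => (f (z, u.2)).1) x1 y1.
have [? -> ->] := is_partials (f := fun z => (f (z, u.2)).2) x1' y1'.
have [? -> ->] := is_partials (f := fun z => (f (u.1, z)).1) x2 y2.
have [? -> ->] := is_partials (f := fun z => (f (u.1, z)).2) x2' y2'.
by [].
Qed.

Lemma is_bderive_ecoord (s : R) h t l :
  is_bderive h t l -> is_rderive (fun x => ecoord s (h x)) t (ecoord s l).
Proof.
move=> [h1 h2]; rewrite /ecoord -mulNr.
have -> : (fun x => (h x).1 - s%:C * 'i%C * (h x).2) =
    (fun x => (h x).1 + - (s%:C * 'i%C) * (h x).2).
  by apply/funext => x; rewrite mulNr.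
exact/is_rderiveD/is_rderiveZ.
Qed.

Lemma is_bderive_epoint (s : R) (h k : R -> R[i]) t l m :
  is_rderive h t l -> is_rderive k t m ->
  is_bderive (fun x => epoint s (h x) (k x)) t (epoint s l m).
Proof.
move=> hl km; split => /=; apply: is_rderiveZ; first exact: is_rderiveD.
rewrite -mulN1r.
have -> : (fun x => h x - k x) = (fun x => h x + -1 * k x).
  by apply/funext => x; rewrite mulN1r.
exact/is_rderiveD/is_rderiveZ.
Qed.

Lemma continuous_slice (T : topologicalType) (x : T) (a b c d : T -> R) :
  {for x, continuous a} -> {for x, continuous b} ->
  {for x, continuous c} -> {for x, continuous d} ->
  {for x, continuous (fun y => (a y +i* b y, c y +i* d y) : bicomplex R)}.
Proof. by move=> *; apply: continuous_pair_at; exact: continuous_Complex_at. Qed.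

End BicomplexPartials.

(** * Restriction to a line of constant idempotent coordinate *)

Section IdempotentSlices.
Context {R : realType}.
Variables (D0 : set (bicomplex R)) (w : bicomplex R -> bicomplex R).
Variables (s tau : R).
Hypotheses (oD0 : open D0) (wC1 : bc_C1_on D0 w).

Lemma half_realC : (2^-1 : R[i]) = (2^-1)%:C.
Proof. by rewrite fmorphV rmorph_nat. Qed.

(** A real step of the coordinate of sign [s] moves [Re u.1] and [Im u.2]
    together, so a single partial derivative in the new coordinates is a
    derivative along a diagonal in the old ones.  The shape [1 * t - _] is the
    one expected by [is_rderive_affine]. *)
Lemma epoint_xslice z z' t : let u := epoint s z z' in
  epoint s (t +i* Im z) z' =
  ((2^-1 * (1 * t - Re z) + Re u.1) +i* Im u.1,
   Re u.2 +i* (2^-1 * s * (1 * t - Re z) + Im u.2)).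
Proof.
case: z z' => [a b] [c d]; rewrite /epoint half_realC.
by congr pair; apply/eqP; rewrite eq_complex /=; apply/andP; split; apply/eqP; ring.
Qed.

(** An imaginary step of the coordinate of sign [s] moves [Im u.1] and [Re u.2],
    in opposite directions when [s = 1]. *)
Lemma epoint_yslice z z' t : let u := epoint s z z' in
  epoint s (Re z +i* t) z' =
  (Re u.1 +i* (2^-1 * (1 * t - Im z) + Im u.1),
   (- (2^-1 * s) * (1 * t - Im z) + Re u.2) +i* Im u.2).
Proof.
case: z z' => [a b] [c d]; rewrite /epoint half_realC.
by congr pair; apply/eqP; rewrite eq_complex /=; apply/andP; split; apply/eqP; ring.
Qed.

Lemma is_rderive_epoint_x z z' (u := epoint s z z') : D0 u ->
  is_rderive (xslice (fun z => ecoord tau (w (epoint s z z'))) z) (Re z)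
    ((2^-1)%:C * ecoord tau (on1 partial_x w u)
     + (2^-1 * s)%:C * ecoord tau (on2 partial_y w u)).
Proof.
move=> Du; rewrite /xslice; under eq_fun do rewrite epoint_xslice.
rewrite -/u -[X in is_rderive _ _ X]mul1r.
(* The plane of the two real variables that move. *)
pose mk (x : R * R) : bicomplex R := (x.1 +i* Im u.1, Re u.2 +i* x.2).
have mku : mk (Re u.1, Im u.2) = u by rewrite /mk; case: (u) => [[? ?] [? ?]].
have mkc : {for (Re u.1, Im u.2), continuous mk}.
  apply: continuous_slice; [exact: cvg_fst|exact: cvg_cst|exact: cvg_cst|exact: cvg_snd].
have [uP [cX _ _ _]] := wC1 Du.
have [dX dY1 dX2 dY2] := bc_partials_atP uP.
apply: (@is_rderive_affine _ (fun t => ecoord tau (w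
  ((2^-1 * t + Re u.1) +i* Im u.1, Re u.2 +i* (2^-1 * s * t + Im u.2)))) 1 (- Re z)).
rewrite mul1r subrr.
rewrite -[in on1 _ _ _]mku.
apply: (@is_rderive_diagonal _
  (fun p q => ecoord tau (w (p +i* Im u.1, Re u.2 +i* q)))
  (fun p q => ecoord tau (on1 partial_x w (mk (p, q)))) (Re u.1) (Im u.2)).
- have : \forall x \near (Re u.1, Im u.2), D0 (mk x).
    by apply: mkc; rewrite mku; exact: open_nbhs_nbhs.
  apply: filterS => x /wC1[/bc_partials_atP[+ _ _ _] _].
  by move=> /(is_bderive_ecoord tau); case: x.
- have -> : (fun x : R * R => ecoord tau (on1 partial_x w (mk (x.1, x.2)))) =
      (fun x => ecoord tau (on1 partial_x w (mk x))) by apply/funext => -[].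
  apply: continuous_ecoord_at; apply: (@continuous_comp (R * R)%type (bicomplex R)
    (bicomplex R) mk (on1 partial_x w) (Re u.1, Im u.2) mkc).
  by rewrite mku.
by have := is_bderive_ecoord tau dY2; case: (u) => [[? ?] [? ?]].
Qed.

Lemma is_rderive_epoint_y z z' (u := epoint s z z') : D0 u ->
  is_rderive (yslice (fun z => ecoord tau (w (epoint s z z'))) z) (Im z)
    ((2^-1)%:C * ecoord tau (on1 partial_y w u)
     + (- (2^-1 * s))%:C * ecoord tau (on2 partial_x w u)).
Proof.
move=> Du; rewrite /yslice; under eq_fun do rewrite epoint_yslice.
rewrite -/u -[X in is_rderive _ _ X]mul1r.
(* The plane of the two real variables that move. *)
pose mk (x : R * R) : bicomplex R := (Re u.1 +i* x.1, x.2 +i* Im u.2).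
have mku : mk (Im u.1, Re u.2) = u by rewrite /mk; case: (u) => [[? ?] [? ?]].
have mkc : {for (Im u.1, Re u.2), continuous mk}.
  apply: continuous_slice; [exact: cvg_cst|exact: cvg_fst|exact: cvg_snd|exact: cvg_cst].
have [uP [_ cY _ _]] := wC1 Du.
have [dX dY1 dX2 dY2] := bc_partials_atP uP.
apply: (@is_rderive_affine _ (fun t => ecoord tau (w
  (Re u.1 +i* (2^-1 * t + Im u.1), (- (2^-1 * s) * t + Re u.2) +i* Im u.2))) 1 (- Im z)).
rewrite mul1r subrr.
rewrite -[in on1 _ _ _]mku.
apply: (@is_rderive_diagonal _
  (fun p q => ecoord tau (w (Re u.1 +i* p, q +i* Im u.2)))
  (fun p q => ecoord tau (on1 partial_y w (mk (p, q)))) (Im u.1) (Re u.2)).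
- have : \forall x \near (Im u.1, Re u.2), D0 (mk x).
    by apply: mkc; rewrite mku; exact: open_nbhs_nbhs.
  apply: filterS => x /wC1[/bc_partials_atP[_ + _ _] _].
  by move=> /(is_bderive_ecoord tau); case: x.
- have -> : (fun x : R * R => ecoord tau (on1 partial_y w (mk (x.1, x.2)))) =
      (fun x => ecoord tau (on1 partial_y w (mk x))) by apply/funext => -[].
  apply: continuous_ecoord_at; apply: (@continuous_comp (R * R)%type (bicomplex R)
    (bicomplex R) mk (on1 partial_y w) (Im u.1, Re u.2) mkc).
  by rewrite mku.
by have := is_bderive_ecoord tau dX2; case: (u) => [[? ?] [? ?]].
Qed.

(** The chain rule for the passage from the variables [z1, z2] to the idempotent
    coordinates, with the other coordinate held fixed at [z']. *)
Lemma epoint_partials z z' (u := epoint s z z')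
    (k := fun z => ecoord tau (w (epoint s z z'))) : D0 u ->
  [/\ partials_at k z,
      partial_x k z = (2^-1)%:C * ecoord tau (on1 partial_x w u)
        + (2^-1 * s)%:C * ecoord tau (on2 partial_y w u)
    & partial_y k z = (2^-1)%:C * ecoord tau (on1 partial_y w u)
        + (- (2^-1 * s))%:C * ecoord tau (on2 partial_x w u)].
Proof. by move=> Du; apply: is_partials; [exact: is_rderive_epoint_x|exact: is_rderive_epoint_y]. Qed.

Lemma epoint_C1_on (D : set R[i]) z' : open D ->
  (forall z, D z -> D0 (epoint s z z')) ->
  C1_on D (fun z => ecoord tau (w (epoint s z z'))).
Proof.
move=> oD DD0 z Dz; have Du := DD0 _ Dz.
have [kz _ _] := epoint_partials Du.
have [_ [cX1 cY1 cX2 cY2]] := wC1 Du.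
have nD : \forall y \near z, D y by exact: open_nbhs_nbhs.
have ce : {for z, continuous (fun y => epoint s y z')}.
  by apply: continuous_epoint_at; [exact: cvg_id|exact: (@cst_continuous R[i] R[i] z' z)].
have c2 (g h : bicomplex R -> bicomplex R) (al be : R[i]) :
    {for epoint s z z', continuous g} -> {for epoint s z z', continuous h} ->
    {for z, continuous (fun y => al * ecoord tau (g (epoint s y z'))
                               + be * ecoord tau (h (epoint s y z')))}.
  move=> gc hc.
  by apply: continuousD_at; apply: continuousMl_at; apply: continuous_ecoord_at;
    [exact: (@continuous_comp R[i] (bicomplex R) (bicomplex R) _ g z ce gc)
    |exact: (@continuous_comp R[i] (bicomplex R) (bicomplex R) _ h z ce hc)].
split=> //.
  apply: near_eq_continuous_at (c2 _ _ (2^-1)%:C (2^-1 * s)%:C cX1 cY2).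
  by apply: filterS nD => y /DD0 /epoint_partials[_ -> _].
apply: near_eq_continuous_at (c2 _ _ (2^-1)%:C (- (2^-1 * s))%:C cY1 cX2).
by apply: filterS nD => y /DD0 /epoint_partials[_ _ ->].
Qed.

Lemma ecoord_on1_zbar u : ecoord tau (on1 d_zbar w u) =
  2^-1 * (ecoord tau (on1 partial_x w u) + 'i%C * ecoord tau (on1 partial_y w u)).
Proof. by rewrite !on1E /ecoord /d_zbar /=; ring. Qed.

Lemma ecoord_on2_zbar u : ecoord tau (on2 d_zbar w u) =
  2^-1 * (ecoord tau (on2 partial_x w u) + 'i%C * ecoord tau (on2 partial_y w u)).
Proof. by rewrite !on2E /ecoord /d_zbar /=; ring. Qed.

Lemma ecoord_on1_z u : ecoord tau (on1 d_z w u) =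
  2^-1 * (ecoord tau (on1 partial_x w u) - 'i%C * ecoord tau (on1 partial_y w u)).
Proof. by rewrite !on1E /ecoord /d_z /=; ring. Qed.

Lemma ecoord_on2_z u : ecoord tau (on2 d_z w u) =
  2^-1 * (ecoord tau (on2 partial_x w u) - 'i%C * ecoord tau (on2 partial_y w u)).
Proof. by rewrite !on2E /ecoord /d_z /=; ring. Qed.

End IdempotentSlices.

Lemma ecoord_half (R : realType) (s : R) : ecoord s 2^-1 = 2^-1.
Proof. by rewrite two_inv ecoord_ofC. Qed.

(** * The conjugate derivatives in idempotent coordinates *)

(** Here [h] stands for one half, [s * i] for the coordinate of [i2] up to sign,
    and the four capital variables for the partial derivatives in the old real
    variables. *)
Lemma dbar_change_of_variables (K : comRingType) (h s i X1 Y1 X2 Y2 : K) :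
  i * i = -1 ->
  h * (h * (X1 + i * Y1) - s * i * (h * (X2 + i * Y2))) =
  h * (h * X1 + h * s * Y2 + i * (h * Y1 + - (h * s) * X2)).
Proof. by move=> i2; ring: i2. Qed.

Lemma d_change_of_variables (K : comRingType) (h s i X1 Y1 X2 Y2 : K) :
  i * i = -1 ->
  h * (h * (X1 - i * Y1) + s * i * (h * (X2 - i * Y2))) =
  h * (h * X1 + h * s * Y2 - i * (h * Y1 + - (h * s) * X2)).
Proof. by move=> i2; ring: i2. Qed.

Section ConjugateDerivatives.
Context {R : realType}.
Variables (D0 : set (bicomplex R)) (w : bicomplex R -> bicomplex R) (s : R).
Hypotheses (oD0 : open D0) (wC1 : bc_C1_on D0 w) (s2 : s * s = 1).
Variables (z z' : R[i]).

Lemma i_sqr : 'i%C * 'i%C = -1 :> R[i].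
Proof. by rewrite -expr2 sqr_i. Qed.

(** In idempotent coordinates the operator for the third conjugation is the
    Cauchy-Riemann operator of each coordinate in its own variable. *)
Lemma ecoord_d_dag3 : D0 (epoint s z z') ->
  ecoord s (d_dag3 w (epoint s z z')) =
  d_zbar (fun z => ecoord s (w (epoint s z z'))) z.
Proof.
move=> Du; have [_ ex ey] := epoint_partials s oD0 wC1 Du.
rewrite /d_zbar ex ey /d_dag3 ecoordM // ecoord_half ecoordD ecoordM // ecoord_i2.
rewrite ecoord_on1_zbar ecoord_on2_zbar !(rmorphN, rmorphM) /= -half_realC.
by rewrite mulNr; exact: dbar_change_of_variables i_sqr.
Qed.

(** The operators for the first two conjugations instead differentiate each
    coordinate in the variable of the other one: their vanishing is what
    separates the variables. *)
Lemma ecoordN_d_dag1 : D0 (epoint s z z') ->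
  ecoord (- s) (d_dag1 w (epoint s z z')) =
  d_zbar (fun z => ecoord (- s) (w (epoint s z z'))) z.
Proof.
move=> Du; have [_ ex ey] := epoint_partials (- s) oD0 wC1 Du.
have s2N : - s * - s = 1 by rewrite mulrNN.
rewrite /d_zbar ex ey /d_dag1 ecoordM // ecoord_half ecoordD ecoordN ecoordM // ecoord_i2.
rewrite ecoord_on1_zbar ecoord_on2_zbar !(rmorphN, rmorphM) /= -half_realC.
by rewrite [- s%:C * _]mulNr opprK; exact: dbar_change_of_variables i_sqr.
Qed.

Lemma ecoordN_d_dag2 : D0 (epoint s z z') ->
  ecoord (- s) (d_dag2 w (epoint s z z')) =
  d_z (fun z => ecoord (- s) (w (epoint s z z'))) z.
Proof.
move=> Du; have [_ ex ey] := epoint_partials (- s) oD0 wC1 Du.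
have s2N : - s * - s = 1 by rewrite mulrNN.
rewrite /d_z ex ey /d_dag2 ecoordM // ecoord_half ecoordD ecoordM // ecoord_i2.
rewrite ecoord_on1_z ecoord_on2_z !(rmorphN, rmorphM) /= -half_realC.
by rewrite [- s%:C * _]mulNr opprK; exact: d_change_of_variables i_sqr.
Qed.

End ConjugateDerivatives.

(** * Functions that split along the idempotents *)

Section IdempotentFunctions.
Context {R : realType}.
Implicit Types (s : R) (f g h : R[i] -> R[i]) (u : bicomplex R).

(** [ecomb] and [eprod] with the sign of the first factor as a parameter:
    changing [s] into [- s] only swaps the two factors. *)
Definition idem_fun s f f' u : bicomplex R :=
  epoint s (f (ecoord s u)) (f' (ecoord (- s) u)).

Definition idem_set s (D D' : set R[i]) : set (bicomplex R) :=
  [set u | D (ecoord s u) /\ D' (ecoord (- s) u)].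

Lemma epointN s (z z' : R[i]) : epoint (- s) z' z = epoint s z z'.
Proof. by rewrite /epoint rmorphN; congr pair; ring. Qed.

Lemma idem_funN s f f' : idem_fun (- s) f' f = idem_fun s f f'.
Proof. by apply/funext => u; rewrite /idem_fun opprK epointN. Qed.

Lemma idem_setN s D D' : idem_set (- s) D' D = idem_set s D D'.
Proof. by rewrite /idem_set opprK; apply/seteqP; split => u []. Qed.

Lemma ecomb_idem_fun f f' : ecomb f f' = idem_fun 1 f f'.
Proof. by apply/funext => u; rewrite ecombE. Qed.

Lemma eprod_idem_set D D' : eprod D D' = idem_set 1 D D' :> set (bicomplex R).
Proof. by apply/seteqP; split => u /eprodE. Qed.

Lemma idem_set_epoint s D D' z z' : s * s = 1 -> D z -> D' z' ->
  idem_set s D D' (epoint s z z').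
Proof. by move=> s2 Dz Dz'; rewrite /idem_set /= ecoord_epoint // ecoordN_epoint. Qed.

Lemma open_idem_set s D D' : open D -> open D' -> open (idem_set s D D').
Proof.
move=> oD oD'.
have c t : continuous (@ecoord R t).
  by move=> u; apply: (continuous_ecoord_at (f := id)); exact: cvg_id.
have -> : idem_set s D D' = (ecoord s @^-1` D) `&` (ecoord (- s) @^-1` D') by [].
by apply: openI; apply: open_comp => // u _; exact: c.
Qed.

Lemma ecoordE s (a b c d : R) :
  ecoord s (a +i* b, c +i* d) = (a + s * d) +i* (b - s * c).
Proof. by apply/eqP; rewrite eq_complex /=; apply/andP; split; apply/eqP; ring. Qed.

(** The coordinate of sign [s] has real part [Re u.1 + s * Im u.2] and imaginary
    part [Im u.1 - s * Re u.2], so along each real variable it moves by a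
    translation or a reflection, and the chain rule is the affine one. *)
Lemma is_rderive_comp_ecoord s h u : partials_at h (ecoord s u) ->
  [/\ is_rderive (fun t => h (ecoord s (t +i* Im u.1, u.2))) (Re u.1)
        (partial_x h (ecoord s u)),
      is_rderive (fun t => h (ecoord s (Re u.1 +i* t, u.2))) (Im u.1)
        (partial_y h (ecoord s u)),
      is_rderive (fun t => h (ecoord s (u.1, t +i* Im u.2))) (Re u.2)
        ((- s)%:C * partial_y h (ecoord s u))
    & is_rderive (fun t => h (ecoord s (u.1, Re u.2 +i* t))) (Im u.2)
        (s%:C * partial_x h (ecoord s u))].
Proof.
case: u => [[a b] [c d]]; rewrite ecoordE => /partials_atP[].
rewrite /xslice /yslice => /= hx hy; split; under eq_fun do rewrite ecoordE.
- rewrite -[X in is_rderive _ _ X]mul1r.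
  under eq_fun do rewrite -[X in X + s * d]mul1r.
  by apply: (@is_rderive_affine _ (fun t => h (t +i* (b - s * c)))); rewrite mul1r.
- rewrite -[X in is_rderive _ _ X]mul1r.
  under eq_fun do rewrite -[X in X - s * c]mul1r.
  by apply: (@is_rderive_affine _ (fun t => h ((a + s * d) +i* t))); rewrite mul1r.
- under eq_fun do rewrite [b - _]addrC -mulNr.
  by apply: (@is_rderive_affine _ (fun t => h ((a + s * d) +i* t))); rewrite mulNr [- _ + b]addrC.
under eq_fun do rewrite [a + _]addrC.
by apply: (@is_rderive_affine _ (fun t => h (t +i* (b - s * c)))); rewrite [_ + a]addrC.
Qed.

Lemma idem_fun_has_partials s f f' u :
  partials_at f (ecoord s u) -> partials_at f' (ecoord (- s) u) ->
  has_partials (idem_fun s f f') u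
    (epoint s (partial_x f (ecoord s u)) (partial_x f' (ecoord (- s) u)))
    (epoint s (partial_y f (ecoord s u)) (partial_y f' (ecoord (- s) u)))
    (epoint s ((- s)%:C * partial_y f (ecoord s u))
              ((- - s)%:C * partial_y f' (ecoord (- s) u)))
    (epoint s (s%:C * partial_x f (ecoord s u))
              ((- s)%:C * partial_x f' (ecoord (- s) u))).
Proof.
move=> /is_rderive_comp_ecoord[x1 y1 x2 y2] /is_rderive_comp_ecoord[x1' y1' x2' y2'].
by split; apply: is_bderive_epoint.
Qed.

(** The partial derivatives of a split function are again split functions, up to
    signs, which gives their continuity. *)
Lemma idem_fun_C1_on s D D' f f' : open D -> open D' ->
  C1_on D f -> C1_on D' f' -> bc_C1_on (idem_set s D D') (idem_fun s f f').
Proof.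
move=> oD oD' fC f'C u Du.
have Q v : idem_set s D D' v -> _ :=
  fun Dv => let: And3 p _ _ := fC _ Dv.1 in let: And3 p' _ _ := f'C _ Dv.2 in
    has_partialsP (idem_fun_has_partials p p').
have [up _] := Q u Du; split; first exact: up.
have nD : \forall v \near u, idem_set s D D' v.
  by apply: open_nbhs_nbhs; split => //; exact: open_idem_set.
have ec t : {for u, continuous (ecoord t)}.
  by apply: (continuous_ecoord_at (f := id)); exact: cvg_id.
have [_ fx fy] := fC _ Du.1; have [_ f'x f'y] := f'C _ Du.2.
have cx : {for u, continuous (fun v => partial_x f (ecoord s v))}.
  exact: (@continuous_comp (bicomplex R) R[i] R[i] _ _ u (ec s) fx).
have cy : {for u, continuous (fun v => partial_y f (ecoord s v))}.
  exact: (@continuous_comp (bicomplex R) R[i] R[i] _ _ u (ec s) fy).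
have c'x : {for u, continuous (fun v => partial_x f' (ecoord (- s) v))}.
  exact: (@continuous_comp (bicomplex R) R[i] R[i] _ _ u (ec (- s)) f'x).
have c'y : {for u, continuous (fun v => partial_y f' (ecoord (- s) v))}.
  exact: (@continuous_comp (bicomplex R) R[i] R[i] _ _ u (ec (- s)) f'y).
split.
- apply: (near_eq_continuous_at _ (continuous_epoint_at cx c'x)).
  by apply: filterS nD => v /Q[_ [-> _ _ _]].
- apply: (near_eq_continuous_at _ (continuous_epoint_at cy c'y)).
  by apply: filterS nD => v /Q[_ [_ -> _ _]].
- apply: (near_eq_continuous_at _ (continuous_epoint_at
    (continuousMl_at cy) (continuousMl_at c'y))).
  by apply: filterS nD => v /Q[_ [_ _ -> _]].
apply: (near_eq_continuous_at _ (continuous_epoint_at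
  (continuousMl_at cx) (continuousMl_at c'x))).
by apply: filterS nD => v /Q[_ [_ _ _ ->]].
Qed.

End IdempotentFunctions.

(** * Locality on an open set *)

Section Locality.
Context {R : realType}.
Variables (D0 : set (bicomplex R)) (w w' : bicomplex R -> bicomplex R).
Hypotheses (oD0 : open D0) (ww' : forall u, D0 u -> w u = w' u).

Lemma near_slice (T : topologicalType) (mk : T -> bicomplex R) (t : T) u :
  mk t = u -> {for t, continuous mk} -> D0 u ->
  \forall x \near t, w (mk x) = w' (mk x).
Proof.
move=> mkt mkc Du.
have : \forall x \near t, D0 (mk x).
  by apply: mkc; rewrite mkt; exact: open_nbhs_nbhs.
by apply: filterS => x /ww'.
Qed.

Lemma near_eq_is_bderive (mk : R -> bicomplex R) (t : R) u l :
  mk t = u -> {for t, continuous mk} -> D0 u ->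
  is_bderive (fun x => w (mk x)) t l -> is_bderive (fun x => w' (mk x)) t l.
Proof.
move=> mkt mkc Du [l1 l2]; have ne := near_slice mkt mkc Du; split.
  by apply: near_eq_is_rderive l1; apply: filterS ne => x ->.
by apply: near_eq_is_rderive l2; apply: filterS ne => x ->.
Qed.

Lemma local_has_partials u X1 Y1 X2 Y2 : D0 u ->
  has_partials w u X1 Y1 X2 Y2 -> has_partials w' u X1 Y1 X2 Y2.
Proof.
case: u => [[a b] [c d]] Du [/= x1 y1 x2 y2]; split => /=.
- apply: near_eq_is_bderive Du x1 => //.
  by apply: continuous_slice; [exact: cvg_id|exact: cvg_cst..].
- apply: near_eq_is_bderive Du y1 => //.
  by apply: continuous_slice; [exact: cvg_cst|exact: cvg_id|exact: cvg_cst..].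
- apply: near_eq_is_bderive Du x2 => //.
  by apply: continuous_slice; [exact: cvg_cst..|exact: cvg_id|exact: cvg_cst].
apply: near_eq_is_bderive Du y2 => //.
by apply: continuous_slice; [exact: cvg_cst..|exact: cvg_id].
Qed.

Lemma local_bc_C1_on : bc_C1_on D0 w -> bc_C1_on D0 w'.
Proof.
move=> wC u Du.
have Q v (Dv : D0 v) := has_partialsP (local_has_partials Dv (bc_partials_atP (wC v Dv).1)).
have [up _] := Q u Du; split; first exact: up.
have nD : \forall v \near u, D0 v by exact: open_nbhs_nbhs.
have [_ [c1 c2 c3 c4]] := wC u Du; split.
- by apply: near_eq_continuous_at c1; apply: filterS nD => v /Q[_ [-> _ _ _]].
- by apply: near_eq_continuous_at c2; apply: filterS nD => v /Q[_ [_ -> _ _]].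
- by apply: near_eq_continuous_at c3; apply: filterS nD => v /Q[_ [_ _ -> _]].
by apply: near_eq_continuous_at c4; apply: filterS nD => v /Q[_ [_ _ _ ->]].
Qed.

Lemma local_d_dag k u : bc_C1_on D0 w -> D0 u -> d_dag k w' u = d_dag k w u.
Proof.
move=> wC Du.
have [_ []] := has_partialsP (local_has_partials Du (bc_partials_atP (wC u Du).1)).
have coords (p q : bicomplex R) : p = q -> p.1 = q.1 /\ p.2 = q.2 by move=> ->.
rewrite !on1E !on2E.
move=> /coords[/= x1 x1'] /coords[/= y1 y1'] /coords[/= x2 x2'] /coords[/= y2 y2'].
case: k; rewrite /= /d_dag1 /d_dag2 /d_dag3 !on1E !on2E /d_zbar /d_z;
  by rewrite x1 x1' y1 y1' x2 x2' y2 y2'.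
Qed.

Lemma local_bc_vekua_solution F G :
  bc_vekua_solution D0 F G w -> bc_vekua_solution D0 F G w'.
Proof.
move=> [wC wE]; split; first exact: local_bc_C1_on.
by move=> k u Du; rewrite local_d_dag // wE // ww'.
Qed.

End Locality.

(** * The Vekua equations in idempotent coordinates *)

Lemma constant_partials (R : realType) (c z : R[i]) :
  [/\ partials_at (fun=> c) z, partial_x (fun=> c) z = 0
    & partial_y (fun=> c) z = 0].
Proof. by apply: is_partials; split; exact: is_derive_cst. Qed.

Lemma d_zbar_constant (R : realType) (c z : R[i]) : d_zbar (fun=> c) z = 0.
Proof. by have [_ x0 y0] := constant_partials c z; rewrite /d_zbar x0 y0 !mulr0 addr0 mulr0. Qed.

Lemma d_z_constant (R : realType) (c z : R[i]) : d_z (fun=> c) z = 0.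
Proof. by have [_ x0 y0] := constant_partials c z; rewrite /d_z x0 y0 mulr0 subr0 mulr0. Qed.

(** The zero solution serves when one of the two domains is empty, where nothing
    can be read off from [w]. *)
Lemma vekua_solution0 (R : realType) (D : set R[i]) (f g : R[i] -> R[i]) :
  vekua_solution D f g (fun=> 0).
Proof.
have px : partial_x (fun=> 0) = (fun=> 0) :> (R[i] -> R[i]).
  by apply/funext => z; have [] := constant_partials (0 : R[i]) z.
have py : partial_y (fun=> 0) = (fun=> 0) :> (R[i] -> R[i]).
  by apply/funext => z; have [] := constant_partials (0 : R[i]) z.
split=> [z _|z _]; last by rewrite d_zbar_constant rmorph0 !mulr0 addr0.
have [p0 _ _] := constant_partials (0 : R[i]) z.
by split; rewrite ?px ?py //; exact: (@cst_continuous R[i] R[i] 0 z).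
Qed.

Lemma partials_d_z_d_zbar0 (R : realType) (f : R[i] -> R[i]) (z : R[i]) :
  d_z f z = 0 -> d_zbar f z = 0 -> partial_x f z = 0 /\ partial_y f z = 0.
Proof.
rewrite /d_z /d_zbar; set p := partial_x f z; set q := partial_y f z.
have n2 : (2^-1 : R[i]) != 0 by rewrite invr_eq0 pnatr_eq0.
have ni : ('i%C : R[i]) != 0 by rewrite eq_complex /= oner_eq0 andbF.
move=> /eqP; rewrite mulf_eq0 (negPf n2) /= subr_eq0 => /eqP pq.
move=> /eqP; rewrite mulf_eq0 (negPf n2) /= pq -mulr2n mulrn_eq0 /= mulf_eq0.
by rewrite (negPf ni) /= => /eqP ->; rewrite mulr0.
Qed.

(** The difference is [- 2 i] times the imaginary part in the hypothesis. *)
Lemma generating_pair_denominator (R : realType) (a b : R[i]) :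
  Im (a^*%C * b) != 0 -> a * b^*%C - a^*%C * b != 0.
Proof.
case: a b => [a a'] [b b'] /= n0; rewrite eq_complex /=; apply/nandP; right.
apply: contraNneq n0 => e0; apply/eqP; move: e0.
have -> : a * - b' + a' * b - (a * b' + - a' * b) = - 2 * (a * b' + - a' * b) by ring.
by move=> /eqP; rewrite mulf_eq0 oppr_eq0 pnatr_eq0 => /eqP.
Qed.

Section VekuaComponents.
Context {R : realType}.
Variables (s : R) (D D' : set R[i]).
Hypotheses (s2 : s * s = 1) (oD : open D) (oD' : open D').
Let D0 := idem_set s D D'.
Let oD0 : open D0 := open_idem_set oD oD'.

Lemma ecoord_idem_fun (f f' : R[i] -> R[i]) z z' :
  ecoord s (idem_fun s f f' (epoint s z z')) = f z.
Proof. by rewrite /idem_fun !ecoord_epoint. Qed.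

Lemma ecoordN_idem_fun (f f' : R[i] -> R[i]) z z' :
  ecoord (- s) (idem_fun s f f' (epoint s z z')) = f' z'.
Proof. by rewrite /idem_fun !ecoordN_epoint. Qed.

Lemma ecoord_d_dag3_idem_fun f f' z z' :
  C1_on D f -> C1_on D' f' -> D z -> D' z' ->
  ecoord s (d_dag3 (idem_fun s f f') (epoint s z z')) = d_zbar f z.
Proof.
move=> fC f'C Dz Dz'.
rewrite (ecoord_d_dag3 oD0 (idem_fun_C1_on oD oD' fC f'C)) //; last first.
  exact: idem_set_epoint.
by under eq_fun do rewrite ecoord_idem_fun.
Qed.

Lemma ecoordN_d_dag1_idem_fun f f' z z' :
  C1_on D f -> C1_on D' f' -> D z -> D' z' ->
  ecoord (- s) (d_dag1 (idem_fun s f f') (epoint s z z')) = 0.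
Proof.
move=> fC f'C Dz Dz'.
rewrite (ecoordN_d_dag1 oD0 (idem_fun_C1_on oD oD' fC f'C)) //; last first.
  exact: idem_set_epoint.
by under eq_fun do rewrite ecoordN_idem_fun; rewrite d_zbar_constant.
Qed.

Lemma ecoordN_d_dag2_idem_fun f f' z z' :
  C1_on D f -> C1_on D' f' -> D z -> D' z' ->
  ecoord (- s) (d_dag2 (idem_fun s f f') (epoint s z z')) = 0.
Proof.
move=> fC f'C Dz Dz'.
rewrite (ecoordN_d_dag2 oD0 (idem_fun_C1_on oD oD' fC f'C)) //; last first.
  exact: idem_set_epoint.
by under eq_fun do rewrite ecoordN_idem_fun; rewrite d_z_constant.
Qed.

Variables (f f' g g' : R[i] -> R[i]).
Hypotheses (fg : generating_pair D f g) (fg' : generating_pair D' f' g').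
Let F := idem_fun s f f'.
Let G := idem_fun s g g'.
Let fC : C1_on D f. Proof. by case: fg => -[]. Qed.
Let gC : C1_on D g. Proof. by case: fg => _ []. Qed.
Let f'C : C1_on D' f'. Proof. by case: fg' => -[]. Qed.
Let g'C : C1_on D' g'. Proof. by case: fg' => _ []. Qed.

(** [ecoord s] is a ring morphism that turns [dag3] into complex conjugation, and
    the denominator is a unit because its two coordinates are the nonzero
    denominators of the two complex equations. *)
Lemma ecoord_bc_vekua3 z z' v : D z -> D' z' ->
  ecoord s (bc_vekua_a K3 F G (epoint s z z') * v
            + bc_vekua_b K3 F G (epoint s z z') * dag3 v) =
  vekua_a f g z * ecoord s v + vekua_b f g z * (ecoord s v)^*%C.
Proof.
move=> Dz Dz'; have s2N : - s * - s = 1 by rewrite mulrNN.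
rewrite /bc_vekua_a /bc_vekua_b /vekua_a /vekua_b /=.
have n0 : f z * (g z)^*%C - (f z)^*%C * g z != 0.
  by apply: generating_pair_denominator; case: fg => _ _; apply.
have n0' : f' z' * (g' z')^*%C - (f' z')^*%C * g' z' != 0.
  by apply: generating_pair_denominator; case: fg' => _ _; apply.
set u := epoint s z z'.
have dE : ecoord s (F u * dag3 (G u) - dag3 (F u) * G u) =
    f z * (g z)^*%C - (f z)^*%C * g z.
  by rewrite ecoordD ecoordN !ecoordM // !ecoord_dag3 !ecoord_idem_fun.
have dE' : ecoord (- s) (F u * dag3 (G u) - dag3 (F u) * G u) =
    f' z' * (g' z')^*%C - (f' z')^*%C * g' z'.
  by rewrite ecoordD ecoordN !ecoordM // !ecoord_dag3 !ecoordN_idem_fun.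
rewrite -dE in n0; rewrite -dE' in n0'.
have VE : ecoord s (F u * dag3 (G u) - dag3 (F u) * G u)^-1 =
    (f z * (g z)^*%C - (f z)^*%C * g z)^-1 by rewrite ecoordV // dE.
have FE : ecoord s (F u) = f z by exact: ecoord_idem_fun.
have GE : ecoord s (G u) = g z by exact: ecoord_idem_fun.
have dFE : ecoord s (d_dag3 F u) = d_zbar f z by exact: ecoord_d_dag3_idem_fun.
have dGE : ecoord s (d_dag3 G u) = d_zbar g z by exact: ecoord_d_dag3_idem_fun.
move: (d_dag3 F u) (d_dag3 G u) dFE dGE => dF dG dFE dGE.
have aE : ecoord s (dag3 (F u) * dG - dF * dag3 (G u)) =
    (f z)^*%C * d_zbar g z - d_zbar f z * (g z)^*%C.
  by rewrite ecoordD ecoordN 2!(ecoordM _ _ s2) !ecoord_dag3 FE GE dFE dGE.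
have bE : ecoord s (F u * dG - dF * G u) =
    f z * d_zbar g z - d_zbar f z * g z.
  by rewrite ecoordD ecoordN 2!(ecoordM _ _ s2) FE GE dFE dGE.
rewrite ecoordD 2!(ecoordM _ _ s2) ecoordN 2!(ecoordM _ _ s2).
by rewrite VE aE bE ecoord_dag3.
Qed.

End VekuaComponents.

Section Equivalence.
Context {R : realType}.
Variables (s : R) (D D' : set R[i]).
Hypotheses (s2 : s * s = 1) (oD : open D) (oD' : open D').
Variables (f f' g g' : R[i] -> R[i]).
Hypotheses (fg : generating_pair D f g) (fg' : generating_pair D' f' g').
Let D0 := idem_set s D D'.
Let oD0 : open D0 := open_idem_set oD oD'.
Let F := idem_fun s f f'.
Let G := idem_fun s g g'.

(** The first two operators differentiate each coordinate in the variable on which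
    a split function does not depend. *)
Lemma d_dag12_idem_fun_eq0 (h h' : R[i] -> R[i]) k u : k <> K3 ->
  C1_on D h -> C1_on D' h' -> D0 u -> d_dag k (idem_fun s h h') u = 0.
Proof.
move=> k3 hC h'C [Du Du']; have s2N : - s * - s = 1 by rewrite mulrNN.
have e0 t : ecoord t (0 : bicomplex R) = 0 by rewrite /ecoord mulr0 subr0.
rewrite -[u](epoint_ecoord _ s2).
apply: (ecoord_inj s2); rewrite e0; case: k k3 => //= _.
- by have := ecoordN_d_dag1_idem_fun s2N oD' oD h'C hC Du' Du;
    rewrite opprK epointN idem_funN.
- by have := ecoordN_d_dag2_idem_fun s2N oD' oD h'C hC Du' Du;
    rewrite opprK epointN idem_funN.
- exact: (ecoordN_d_dag1_idem_fun s2 oD oD' hC h'C Du Du').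
exact: (ecoordN_d_dag2_idem_fun s2 oD oD' hC h'C Du Du').
Qed.

(** Consequently the coefficients of the first two equations vanish, and these
    equations say that [w] is annihilated by the first two operators. *)
Lemma bc_vekua12_rhs_eq0 k u v : k <> K3 -> D0 u ->
  bc_vekua_a k F G u * v + bc_vekua_b k F G u * dag3 v = 0.
Proof.
move=> k3 Du; rewrite /bc_vekua_a /bc_vekua_b.
have [[fC _ _] [gC _ _] _] := fg; have [[f'C _ _] [g'C _ _] _] := fg'.
by rewrite !d_dag12_idem_fun_eq0 // !(mulr0, mul0r) subr0 mul0r oppr0 !mul0r addr0.
Qed.

Variable w : bicomplex R -> bicomplex R.
Hypothesis wsol : bc_vekua_solution D0 F G w.

(** With the other coordinate frozen, the third equation is the complex Vekua
    equation. *)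
Lemma vekua_solution_slice z' : D' z' ->
  vekua_solution D f g (fun z => ecoord s (w (epoint s z z'))).
Proof.
move=> Dz'; have [wC wE] := wsol.
have DD0 z : D z -> D0 (epoint s z z') by move=> Dz; exact: idem_set_epoint.
split=> [|z Dz]; first exact: (epoint_C1_on s oD0 wC oD DD0).
rewrite -(ecoord_d_dag3 oD0 wC s2 (DD0 _ Dz)).
by rewrite -(ecoord_bc_vekua3 s2 oD oD' fg fg' _ Dz Dz') -(wE K3 _ (DD0 _ Dz)).
Qed.

(** The first two equations say that both complex derivatives of the coordinate
    of sign [- s] in the variable of sign [s] vanish. *)
Lemma ecoordN_slice_constant z1 z2 z' : connected D -> D z1 -> D z2 -> D' z' ->
  ecoord (- s) (w (epoint s z1 z')) = ecoord (- s) (w (epoint s z2 z')).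
Proof.
move=> cD D1 D2 Dz'; have [wC wE] := wsol.
have e0 t : ecoord t (0 : bicomplex R) = 0 by rewrite /ecoord mulr0 subr0.
apply: (partials0_constant (g := fun z => ecoord (- s) (w (epoint s z z'))) oD cD) => // z Dz.
have Du : D0 (epoint s z z') by exact: idem_set_epoint.
have [kz _ _] := epoint_partials (- s) oD0 wC Du.
have [] := @partials_d_z_d_zbar0 _ (fun z => ecoord (- s) (w (epoint s z z'))) z.
- rewrite -(ecoordN_d_dag2 oD0 wC s2 Du).
  by have := wE K2 _ Du; rewrite bc_vekua12_rhs_eq0 //= => ->; rewrite e0.
- rewrite -(ecoordN_d_dag1 oD0 wC s2 Du).
  by have := wE K1 _ Du; rewrite bc_vekua12_rhs_eq0 //= => ->; rewrite e0.
by split.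
Qed.

End Equivalence.

(** The converse for functions that are split everywhere; the general case
    follows since the equations are local. *)
Lemma bc_vekua_solution_idem_fun (R : realType) (s : R) (D D' : set R[i])
    (f f' g g' w w' : R[i] -> R[i]) :
  s * s = 1 -> open D -> open D' ->
  generating_pair D f g -> generating_pair D' f' g' ->
  vekua_solution D f g w -> vekua_solution D' f' g' w' ->
  bc_vekua_solution (idem_set s D D') (idem_fun s f f') (idem_fun s g g')
    (idem_fun s w w').
Proof.
move=> s2 oD oD' fg fg' [wC wE] [w'C w'E]; split; first exact: idem_fun_C1_on.
have s2N : - s * - s = 1 by rewrite mulrNN.
move=> k u Du; case: k.
- by rewrite (bc_vekua12_rhs_eq0 s2 oD oD' fg fg') // (d_dag12_idem_fun_eq0 s2 oD oD').
- by rewrite (bc_vekua12_rhs_eq0 s2 oD oD' fg fg') // (d_dag12_idem_fun_eq0 s2 oD oD').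
case: Du => Du Du'; rewrite -[u](epoint_ecoord _ s2); apply: (ecoord_inj s2).
  rewrite (ecoord_bc_vekua3 s2 oD oD' fg fg') //.
  by rewrite (ecoord_d_dag3_idem_fun s2 oD oD') // ecoord_idem_fun // wE.
rewrite -epointN -!(idem_funN s).
rewrite (ecoord_bc_vekua3 s2N oD' oD fg' fg) //.
by rewrite (ecoord_d_dag3_idem_fun s2N oD' oD) // ecoord_idem_fun // w'E.
Qed.

(** * The equivalence *)

Unset Implicit Arguments.
Set Strict Implicit.

Theorem theorem13 (R : realType) (D1 D2 : set R[i])
  (open_D1 : open D1) (connected_D1 : connected D1)
  (open_D2 : open D2) (connected_D2 : connected D2)
  (Fe1 Ge1 Fe2 Ge2 : R[i] -> R[i])
  (pair1 : generating_pair D1 Fe1 Ge1) (pair2 : generating_pair D2 Fe2 Ge2)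
  (w : bicomplex R -> bicomplex R) :
  bc_vekua_solution (eprod D1 D2) (ecomb Fe1 Fe2) (ecomb Ge1 Ge2) w <->
  exists we1 we2 : R[i] -> R[i],
    [/\ vekua_solution D1 Fe1 Ge1 we1,
        vekua_solution D2 Fe2 Ge2 we2
      & forall u, eprod D1 D2 u -> w u = ecomb we1 we2 u].
Proof.
have s2 : 1 * 1 = 1 :> R by rewrite mulr1.
have s2N : - 1 * - 1 = 1 :> R by rewrite mulrNN.
rewrite !ecomb_idem_fun eprod_idem_set; split=> [wsol|]; last first.
  move=> [we1 [we2 [sol1 sol2 wE]]].
  apply: (local_bc_vekua_solution (w := ecomb we1 we2)).
  - exact: open_idem_set.
  - by move=> u /wE.
  rewrite ecomb_idem_fun; exact: bc_vekua_solution_idem_fun.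
have wsolN : bc_vekua_solution (idem_set (- 1) D2 D1)
    (idem_fun (- 1) Fe2 Fe1) (idem_fun (- 1) Ge2 Ge1) w.
  by rewrite idem_setN !idem_funN.
(* If a domain is empty then so is the product, and any solutions will do. *)
have [[z1 Dz1]|D10] := pselect (exists z, D1 z); last first.
  exists (fun=> 0), (fun=> 0); split; [exact: vekua_solution0..|].
  by move=> u [Du _]; case: D10; eexists; exact: Du.
have [[z2 Dz2]|D20] := pselect (exists z, D2 z); last first.
  exists (fun=> 0), (fun=> 0); split; [exact: vekua_solution0..|].
  by move=> u [_ Du]; case: D20; eexists; exact: Du.
(* Each component is read off on a slice through an arbitrary base point. *)
exists (fun z => ecoord 1 (w (epoint 1 z z2))),
       (fun z => ecoord (- 1) (w (epoint (- 1) z z1))); split.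
- exact: (vekua_solution_slice s2 open_D1 open_D2 pair1 pair2 wsol).
- exact: (vekua_solution_slice s2N open_D2 open_D1 pair2 pair1 wsolN).
move=> u [Du Du']; rewrite ecomb_idem_fun /idem_fun; apply: (ecoord_inj s2).
  rewrite ecoord_epoint // -{1}[u](epoint_ecoord _ s2).
  have := ecoordN_slice_constant s2N open_D2 open_D1 pair2 pair1 wsolN
    connected_D2 Du' Dz2 Du.
  by rewrite opprK !epointN.
rewrite ecoordN_epoint // -{1}[u](epoint_ecoord _ s2) epointN.
exact: (ecoordN_slice_constant s2 open_D1 open_D2 pair1 pair2 wsol).
Qed.
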